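(* Let $G$ be a connected ELC-preserved graph on $k$ vertices and let $m>1$ be an integer, with $(k,m)\neq(1,2)$. Let $C^m(G)$ be the graph on $n=km$ vertices obtained from $G$ by substituting every vertex of $G$ with the complete graph $c^m$. Then $C^m(G)$ is an ELC-preserved non-bipartite graph.
   Context: All graphs are finite, simple and undirected. For a graph $G=(V,E)$ and $v\in V$, $N_v$ is the set of vertices adjacent to $v$. Local complementation (LC) on $v$ transforms $G$ into $G*v$ by replacing the induced subgraph of $G$ on $N_v$ by its complement. For an edge $\{u,v\}\in E$, edge local complementation (ELC) on $\{u,v\}$ transforms $G$ into $G^{(u,v)}=G*u*v*u=G*v*u*v$ (operations applied from left to right). $G$ is ELC-preserved if for every edge $\{u,v\}\in E$, $G^{(u,v)}$ is isomorphic to $G$. $c^m$ denotes the complete graph on $m$ vertices. Substituting a vertex $v$ of $G=(V,E)$ with a graph $H=(V',E')$, $V\cap V'=\emptyset$, means forming the graph with vertex set $(V\setminus\{v\})\cup V'$ whose edge set is obtained from $E\cup E'$ by removing all edges incident on $v$ and joining all vertices in $V'$ to $w$ whenever $\{v,w\}\in E$. (Substituting all vertices with $c^m$: two vertices in the copies replacing distinct $v,w$ are adjacent if and only if $\{v,w\}\in E$.) *)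

(* Defs.v *)
From mathcomp Require Import all_boot.

Set Implicit Arguments.
Unset Strict Implicit.
Unset Printing Implicit Defensive.

Record sgraph := SGraph {
  vertex :> finType;
  adj : rel vertex;
  adj_sym : symmetric adj;
  adj_irrefl : irreflexive adj
}.

Arguments adj {s} x y.

(* The empty graph is not connected. *)
Definition connected (G : sgraph) : Prop :=
  0 < #|G| /\ forall x y : G, connect adj x y.

Definition bipartite (G : sgraph) : Prop :=
  exists A : {set G}, forall x y : G, adj x y -> (x \in A) != (y \in A).

Definition isomorphic (G H : sgraph) : Prop :=
  exists2 f : G -> H, bijective f & {mono f : x y / adj x y}.

Section LocalComplementation.
Variables (G : sgraph) (v : G).

Definition lc_adj : rel G := fun x y =>
  if [&& adj v x, adj v y & x != y] then ~~ adj x y else adj x y.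

Lemma lc_adj_sym : symmetric lc_adj.
Proof. by move=> x y; rewrite /lc_adj andbCA eq_sym (adj_sym x y). Qed.

Lemma lc_adj_irrefl : irreflexive lc_adj.
Proof. by move=> x; rewrite /lc_adj eqxx !andbF adj_irrefl. Qed.

Definition lc : sgraph := SGraph lc_adj_sym lc_adj_irrefl.

End LocalComplementation.

Definition elc (G : sgraph) (u v : G) : sgraph := @lc (@lc (@lc G u) v) u.

(* The order of the end points of the edge is immaterial:
   G * u * v * u = G * v * u * v. *)
Lemma elcC (G : sgraph) (u v x y : G) :
  adj u v -> @adj (elc u v) x y = @adj (elc v u) x y.
Proof.
move=> uv; have vu : adj v u by rewrite adj_sym.
have /negPf nuv : u != v by apply: contraTneq uv => ->; rewrite adj_irrefl.
have nvu : (v == u) = false by rewrite eq_sym.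
rewrite /= /lc_adj /= /lc_adj /= /lc_adj.
have [->|/negPf xu] := eqVneq x u; last have [->|/negPf xv] := eqVneq x v;
(have [->|/negPf yu] := eqVneq y u; last have [->|/negPf yv] := eqVneq y v);
  rewrite ?(adj_sym x u) ?(adj_sym x v) ?(adj_sym y u) ?(adj_sym y v)
    ?adj_irrefl ?uv ?vu ?nuv ?nvu ?(eq_sym u x) ?(eq_sym u y) ?(eq_sym v x)
    ?(eq_sym v y) ?xu ?xv ?yu ?yv ?eqxx ?andbF ?andbT //=;
  by case: (adj u x); case: (adj u y); case: (adj v x); case: (adj v y);
     case: (adj x y); case: (x == y).
Qed.

Definition elc_preserved (G : sgraph) : Prop :=
  forall u v : G, adj u v -> isomorphic (elc u v) G.

Section Complete.
Variable m : nat.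

Definition complete_adj : rel 'I_m := fun i j => i != j.

Lemma complete_adj_sym : symmetric complete_adj.
Proof. by move=> i j; rewrite /complete_adj eq_sym. Qed.

Lemma complete_adj_irrefl : irreflexive complete_adj.
Proof. by move=> i; rewrite /complete_adj eqxx. Qed.

Definition complete_graph : sgraph :=
  SGraph complete_adj_sym complete_adj_irrefl.

End Complete.

(* All vertices of G are substituted with H simultaneously: the vertices (v, i)
   with v fixed form the copy of H that replaces v. *)
Section Substitution.
Variables G H : sgraph.

Definition subst_adj : rel (G * H)%type := fun p q =>
  if p.1 == q.1 then adj p.2 q.2 else adj p.1 q.1.

Lemma subst_adj_sym : symmetric subst_adj.
Proof.
by move=> p q; rewrite /subst_adj eq_sym (adj_sym p.1) (adj_sym p.2).
Qed.

Lemma subst_adj_irrefl : irreflexive subst_adj.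
Proof. by move=> p; rewrite /subst_adj eqxx adj_irrefl. Qed.

Definition subst_all : sgraph := SGraph subst_adj_sym subst_adj_irrefl.

End Substitution.

Definition clique_subst (m : nat) (G : sgraph) : sgraph :=
  subst_all G (complete_graph m).

(* Main.v *)
Require Import Defs.
From mathcomp Require Import all_boot.

(** Over the field with two elements, edge local complementation on an edge
    [uv] has a formula that treats all vertices, [u] and [v] included, alike:
    it adds the symmetric form [N[u] x * N[v] y + N[v] x * N[u] y] to the
    adjacency of [x] and [y], where [N[u]] is the closed neighbourhood of [u]
    ([elc_adjE]).

    Substituting every vertex with a complete graph turns each vertex into a
    class of closed twins, so the closed neighbourhood of [(u, i)] is the
    preimage of that of [u] under the projection to [G] ([cl_nbrs_subst]).  Hence
    - on an edge inside a copy of the complete graph, the two closed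
      neighbourhoods agree, the form vanishes and nothing changes;
    - on an edge above an edge [uv] of [G], the form is the pullback of the
      form for [uv].  It vanishes between vertices of the same copy, so the
      operation commutes with the substitution: the result is [C^m] of
      [G^(u,v)], which is isomorphic to [C^m(G)] since [G^(u,v)] is isomorphic
      to [G].

    The graph obtained is not bipartite because it has a triangle: inside one
    copy when [m > 2], and otherwise on two copies of one end of an edge of [G]
    and a copy of the other end, an edge that exists as soon as [k > 1]. *)

Definition cl_nbrs {G : sgraph} (u : G) : pred G :=
  fun x => (x == u) || adj u x.

(** The usual description of this operation toggles the pairs of vertices from
    different classes among the neighbours of [u] only, of [v] only and of
    both, and then exchanges [u] and [v].  The closed neighbourhoods put [u]
    and [v] themselves in the class of common neighbours, and toggling their
    pairs too has the effect of the exchange. *)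
Lemma elc_adjE {G : sgraph} {u v : G} (x y : G) :
  adj u v ->
  @adj (elc u v) x y =
    adj x y (+) (cl_nbrs u x && cl_nbrs v y (+) cl_nbrs v x && cl_nbrs u y).
Proof.
move=> uv; have vu : adj v u by rewrite adj_sym.
have /negPf nuv : u != v by apply: contraTneq uv => ->; rewrite adj_irrefl.
have nvu : (v == u) = false by rewrite eq_sym.
have [<-|nxy] := eqVneq x y.
  by rewrite !adj_irrefl andbC addbb.
rewrite /cl_nbrs /= /lc_adj /= /lc_adj /= /lc_adj; move: nxy.
have [->|/negPf xu] := eqVneq x u; last have [->|/negPf xv] := eqVneq x v;
(have [->|/negPf yu] := eqVneq y u; last have [->|/negPf yv] := eqVneq y v);
  rewrite ?(adj_sym x u) ?(adj_sym x v) ?(adj_sym y u) ?(adj_sym y v)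
    ?adj_irrefl ?uv ?vu ?nuv ?nvu ?(eq_sym u x) ?(eq_sym u y) ?(eq_sym v x)
    ?(eq_sym v y) ?xu ?xv ?yu ?yv ?eqxx ?andbF ?andbT //= => nxy;
  rewrite ?(negPf nxy) ?nxy;
  by case: (adj u x); case: (adj u y); case: (adj v x); case: (adj v y);
     case: (adj x y).
Qed.

(** Closed neighbourhoods do not see the second components because distinct
    vertices of one copy are adjacent: this is where substituting complete
    graphs, and not other graphs, matters. *)
Lemma cl_nbrs_subst {m : nat} {G : sgraph} (p q : clique_subst m G) :
  cl_nbrs p q = cl_nbrs p.1 q.1.
Proof.
case: p q => [u i] [x l]; rewrite /cl_nbrs /= /subst_adj /= /complete_adj.
by rewrite xpair_eqE (eq_sym u x) (eq_sym i l); case: (x == u); case: (l == i).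
Qed.

Lemma elc_clique_subst_copy {m : nat} {G : sgraph} {p q : clique_subst m G} :
  adj p q -> p.1 = q.1 ->
  forall x y : clique_subst m G, @adj (elc p q) x y = adj x y.
Proof.
move=> pq e x y.
by rewrite (elc_adjE _ _ pq) !cl_nbrs_subst e addbb addbF.
Qed.

(** The equality holds on the nose, on the vertex set [G * 'I_m] common to both
    sides: the exchange of the single vertices [p] and [q] and the exchange of
    the whole copies above [p.1] and [q.1] turn out to be the same, because
    toggling the pairs with a neighbour of only one of [p.1] and [q.1] moves the
    other vertices of the two copies exactly as [p] and [q] move. *)
Lemma elc_clique_subst_edge {m : nat} {G : sgraph} {p q : clique_subst m G} :
  adj p q -> adj p.1 q.1 ->
  forall x y,
    @adj (elc p q) x y = @adj (clique_subst m (elc p.1 q.1)) x y.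
Proof.
move=> pq uv x y.
rewrite (elc_adjE _ _ pq) !cl_nbrs_subst.
rewrite -[X in X (+) _]/(@subst_adj G (complete_graph m) x y).
rewrite -[RHS]/(@subst_adj (elc p.1 q.1) (complete_graph m) x y) /subst_adj.
have [->|_] := eqVneq x.1 y.1.
  by rewrite andbC addbb addbF.
by rewrite (elc_adjE _ _ uv).
Qed.

Lemma isomorphic_subst_all {G G' : sgraph} (H : sgraph) :
  isomorphic G G' -> isomorphic (subst_all G H) (subst_all G' H).
Proof.
case=> f [g fK gK] fadj.
exists (fun p : subst_all G H => (f p.1, p.2) : subst_all G' H).
  by exists (fun p => (g p.1, p.2)) => -[x i] /=; rewrite ?fK ?gK.
by move=> p q; rewrite /= /subst_adj /= (can_eq fK) fadj.
Qed.

Lemma elc_preserved_clique_subst (m : nat) (G : sgraph) :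
  elc_preserved G -> elc_preserved (clique_subst m G).
Proof.
move=> hG p q pq; have [e|ne] := eqVneq p.1 q.1.
  exists id; first by exists id.
  by move=> x y; exact: esym (elc_clique_subst_copy pq e x y).
have uv : adj p.1 q.1 by move: pq; rewrite /= /subst_adj (negPf ne).
have [f bf fadj] := isomorphic_subst_all (complete_graph m) (hG _ _ uv).
by exists f => // x y; apply: etrans (fadj x y) (esym _);
   exact: (elc_clique_subst_edge pq uv).
Qed.

Lemma triangle_not_bipartite {G : sgraph} {x y z : G} :
  adj x y -> adj y z -> adj x z -> ~ bipartite G.
Proof.
move=> xy yz xz [A hA]; move: (hA _ _ xy) (hA _ _ yz) (hA _ _ xz).
by case: (x \in A); case: (y \in A); case: (z \in A).
Qed.

Lemma connected_edge {G : sgraph} :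
  connected G -> 1 < #|G| -> exists u v : G, adj u v.
Proof.
move=> [_ conn] /card_gt1P [x [y [_ _ nxy]]].
have /connectP [[|z p] /=] := conn x y.
  by move=> _ e; rewrite e eqxx in nxy.
by case/andP=> xz _ _; exists x, z.
Qed.

Lemma clique_subst_not_bipartite (m : nat) (G : sgraph) :
  connected G -> 1 < m -> (#|G|, m) <> (1, 2) ->
  ~ bipartite (clique_subst m G).
Proof.
move=> conn m_gt1 ne.
pose i0 := Ordinal (ltnW m_gt1); pose i1 := Ordinal m_gt1.
have [m_gt2|m_le2] := ltnP 2 m.
  have /card_gt0P [x _] := conn.1.
  pose i2 := Ordinal m_gt2; pose c i : clique_subst m G := (x, i).
  by apply: (@triangle_not_bipartite _ (c i0) (c i1) (c i2));
     rewrite /= /subst_adj /= eqxx.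
have G_gt1 : 1 < #|G|.
  rewrite ltn_neqAle conn.1 andbT; apply/eqP => G1; apply: ne.
  by rewrite -G1; congr pair; apply/eqP; rewrite eqn_leq m_le2.
have [u [v uv]] := connected_edge conn G_gt1.
have nuv : (u == v) = false.
  by apply/negbTE; apply: contraTneq uv => ->; rewrite adj_irrefl.
pose a : clique_subst m G := (u, i0); pose b : clique_subst m G := (u, i1).
by apply: (@triangle_not_bipartite _ a b ((v, i0) : clique_subst m G));
   rewrite /= /subst_adj /= ?eqxx ?nuv.
Qed.

Theorem theorem4 (k m : nat) (G : sgraph)
    (hk : #|G| = k) (hconn : connected G) (hG : elc_preserved G)
    (hm : 1 < m) (hkm : (k, m) <> (1, 2)) :
  [/\ #|clique_subst m G| = k * m,
      elc_preserved (clique_subst m G)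
    & ~ bipartite (clique_subst m G)].
Proof.
split; first by rewrite card_prod card_ord hk.
  exact: elc_preserved_clique_subst.
by apply: clique_subst_not_bipartite => //; rewrite hk.
Qed.
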